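(* Let $\mathcal A$ be a van Hove sequence in $G$ and let $f,g\in L^\infty(G)$. If the twisted Eberlein convolution $[f,g]_{\mathcal A}$ exists, then $$[\tau_tf,\tau_tg]_{\mathcal A}=[f,g]_{\mathcal A}=\tau_t[f,\tau_tg]_{\mathcal A}$$ holds for all $t\in G$. Moreover, for $f,g,h\in L^\infty(G)$ and $a,b\in\mathbb C$, as long as the twisted Eberlein convolutions involved exist, they have the following properties: (i) $[g,f]_{\mathcal A}=\widetilde{[f,g]_{\mathcal A}}$ (conjugate symmetry); (ii) $[af+bh,g]_{\mathcal A}=a[f,g]_{\mathcal A}+b[h,g]_{\mathcal A}$ (linearity in the first argument); (iii) $[f,ag+bh]_{\mathcal A}=\bar a[f,g]_{\mathcal A}+\bar b[f,h]_{\mathcal A}$ (conjugate linearity in the second argument); (iv) $[f,f]_{\mathcal A}$ is positive definite; (v) $\|[f,g]_{\mathcal A}\|_\infty\le\|f\|_{b,2,\mathcal A}\,\|g\|_{b,2,\mathcal A}$ (Cauchy–Schwarz type inequality); (vi) $[f,f]_{\mathcal A}(0)=\|[f,f]_{\mathcal A}\|_\infty=\|f\|_{b,2,\mathcal A}^2$.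
   Context: $G$ is a second countable, locally compact (Hausdorff) Abelian group with Haar measure $|\cdot|$. A van Hove sequence is a sequence $\mathcal A=(A_n)_{n\in\mathbb N}$ of precompact open subsets of $G$ (of positive measure) such that $\lim_{n}|\partial^K A_n|/|A_n|=0$ for each compact $K\subseteq G$, where for open $A$, $\partial^K A:=(\overline{A+K}\setminus A)\cup(((G\setminus A)-K)\cap\overline A)$. For $g$ on $G$ put $(\tau_tg)(x)=g(x-t)$ and $\widetilde g(x)=\overline{g(-x)}$. For measurable $f,g:G\to\mathbb C$, the twisted Eberlein convolution $[f,g]_{\mathcal A}$ is the function on $G$ given by $[f,g]_{\mathcal A}(t)=\lim_{n\to\infty}\frac1{|A_n|}\int_{A_n}f(s)\overline{g(s-t)}\,ds$; it is said to exist if this limit exists for all $t\in G$. For $f\in L^2_{\mathrm{loc}}(G)$, $\|f\|_{b,2,\mathcal A}=(\limsup_{n}\frac1{|A_n|}\int_{A_n}|f(t)|^2\,dt)^{1/2}$. $\|\cdot\|_\infty$ is the supremum norm. A function $f:G\to\mathbb C$ is positive definite if $\sum_{i,j=1}^nc_if(x_i-x_j)\overline{c_j}\ge0$ for all $n\in\mathbb N$, $x_1,\dots,x_n\in G$, $c_1,\dots,c_n\in\mathbb C$. *)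

(* Defs.v *)
From HB Require Import structures.
From mathcomp Require Import all_boot all_order all_algebra.
From mathcomp Require Import all_classical all_reals all_analysis.
From mathcomp Require Import complex.

Set Implicit Arguments.
Unset Strict Implicit.
Unset Printing Implicit Defensive.

Import Order.TTheory GRing.Theory Num.Theory.
Import numFieldNormedType.Exports.

Local Open Scope classical_set_scope.
Local Open Scope ring_scope.

(* [borel G] is convertible to [G]; the alias only selects the Borel
   sigma-algebra (and the base point 0 that measurable types require). *)
Definition borel (G : topologicalZmodType) : Type := G.

HB.instance Definition _ (G : topologicalZmodType) := Choice.on (borel G).
HB.instance Definition _ (G : topologicalZmodType) :=
  isPointed.Build (borel G) (0 : G).
HB.instance Definition _ (G : topologicalZmodType) :=
  Measurable.copy (borel G)
    (g_sigma_algebraType (@open G : set (set (borel G)))).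

Section Haar.
Context {R : realType} {G : topologicalZmodType}.
Variable mu : {measure set (borel G) -> \bar R}.

(* No regularity clause: on a second countable locally compact Hausdorff
   space, every Borel measure that is finite on compact sets is regular. *)
Record haar_measure : Prop := HaarMeasure {
  haar_invariant : forall (x : G) (B : set (borel G)), measurable B ->
    mu [set x + y | y in (B : set G)] = mu B ;
  haar_compact : forall K : set G, compact K -> (mu K < +oo)%E ;
  haar_neq0 : mu [set: G] <> 0%E
}.

Definition hove_boundary (K A : set G) : set G :=
  (closure [set x + y | x in A & y in K] `\` A) `|`
  ([set x - y | x in ~` A & y in K] `&` closure A).

(* The sets measured below have compact closure, hence finite measure when
   [mu] is a Haar measure, so that [fine] loses no information. *)
Record van_hove (A : nat -> set G) : Prop := VanHove {
  van_hove_open : forall n, open (A n) ;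
  van_hove_precompact : forall n, precompact (A n) ;
  van_hove_gt0 : forall n, (0 < mu (A n))%E ;
  van_hove_boundary : forall K : set G, compact K ->
    (fun n => fine (mu (hove_boundary K (A n))) / fine (mu (A n)))
      @ \oo --> (0 : R)
}.

Definition cmodulus (z : R[i]) : R := complex.Re `|z|.

(* Representatives of elements of L^oo(G); nothing below depends on the choice
   of the representative. *)
Definition Linfty (f : G -> R[i]) : Prop :=
  [/\ measurable_fun [set: borel G] (fun x => complex.Re (f x)),
      measurable_fun [set: borel G] (fun x => complex.Im (f x)) &
      exists M : R, {ae mu, forall x, cmodulus (f x) <= M}].

Definition Cintegral (A : set G) (f : G -> R[i]) : R[i] :=
  Complex (\int[mu]_(x in (A : set (borel G))) complex.Re (f x))
          (\int[mu]_(x in (A : set (borel G))) complex.Im (f x)).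

Definition translate {T : Type} (t : G) (f : G -> T) : G -> T :=
  fun x => f (x - t).

Definition conj_reflect (f : G -> R[i]) : G -> R[i] := fun x => (f (- x))^*.

Definition eberlein_mean (A : nat -> set G) (f g : G -> R[i]) (t : G)
    (n : nat) : R[i]^o :=
  ((fine (mu (A n)))^-1)%:C%C * Cintegral (A n) (fun s => f s * (g (s - t))^*).

Definition eberlein_exists (A : nat -> set G) (f g : G -> R[i]) : Prop :=
  forall t, cvgn (eberlein_mean A f g t).

(* Meaningful under [eberlein_exists A f g]. *)
Definition eberlein (A : nat -> set G) (f g : G -> R[i]) : G -> R[i] :=
  fun t => limn (eberlein_mean A f g t).

Definition besicovitch2 (A : nat -> set G) (f : G -> R[i]) : \bar R :=
  (limn_esup (fun n => ((fine (mu (A n)))^-1)%:E *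
     \int[mu]_(t in (A n : set (borel G))) (cmodulus (f t) ^+ 2)%:E) `^ 2^-1)%E.

Definition sup_norm (f : G -> R[i]) : \bar R :=
  ereal_sup (range (fun t => (cmodulus (f t))%:E)).

Definition positive_definite (f : G -> R[i]) : Prop :=
  forall (n : nat) (x : 'I_n -> G) (c : 'I_n -> R[i]),
    0 <= \sum_(i < n) \sum_(j < n) c i * f (x i - x j) * (c j)^*.

End Haar.

(* Main.v *)
(* Writing [cmean B P] for the mean of [P] over [B], the convolution [[f, g](t)]
   is the limit of [cmean (A n) (f * conj (tau_t g))].  A translate of an
   essentially bounded function has asymptotically the same means, since [A n]
   and [A n - t] differ only by van Hove boundaries; this gives the translation
   identities and conjugate symmetry.  Positive definiteness and the
   Cauchy-Schwarz inequality then come from the positivity of the means of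
   [`|S| ^+ 2], taken before passing to the limit. *)
Require Import Defs.
From mathcomp Require Import all_boot all_order all_algebra.
From mathcomp Require Import all_classical all_reals all_analysis.
From mathcomp Require Import complex.
From mathcomp Require Import measurable_realfun.
From mathcomp Require Import lra ring.

Set Implicit Arguments.
Unset Strict Implicit.
Unset Printing Implicit Defensive.

Import Order.TTheory GRing.Theory Num.Theory.
Import numFieldNormedType.Exports.

Local Open Scope classical_set_scope.
Local Open Scope ring_scope.

(** The van Hove condition controls only measures of boundaries. Essential boundedness turns this
    into control of means: the integral over a piece of a boundary is at most the essential bound
    times the measure of the boundary. Essentially bounded functions are also closed under sums,
    products, conjugation and translation, so every integrand that occurs is integrable over each
    [A n]. Two features shape the Cauchy-Schwarz inequality. The Besicovitch seminorm is a limsup,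
    so the convergence of the means of [f * (tau_t g)^*] says nothing about convergence of the means
    of the squares. Moreover the second factor at stage [n] involves the translate of [g], not [g]
    itself. The inequality is therefore proved at fixed [n], and the limit is taken with an [e] of
    room: once for [f] and twice for [g], for its limsup and for its translation. At [t = 0] with
    [f = g] the means of the squares do converge, which turns the limsup into a limit and yields
    equality. *)

Section ComplexSequences.
Context {R : realType}.
Implicit Types (z w : R[i]) (u v : nat -> R[i]^o).

Lemma conj_conjc z : z^* = conjc z.
Proof. by []. Qed.

Lemma eq_ReIm z w : complex.Re z = complex.Re w ->
  complex.Im z = complex.Im w -> z = w.
Proof. by case: z => a b; case: w => c d /= -> ->. Qed.

Lemma cReD z w : complex.Re (z + w) = complex.Re z + complex.Re w.
Proof. by case: z; case: w. Qed.

Lemma cImD z w : complex.Im (z + w) = complex.Im z + complex.Im w.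
Proof. by case: z; case: w. Qed.

Lemma cReB z w : complex.Re (z - w) = complex.Re z - complex.Re w.
Proof. by case: z; case: w. Qed.

Lemma cImB z w : complex.Im (z - w) = complex.Im z - complex.Im w.
Proof. by case: z; case: w. Qed.

Lemma cReM z w : complex.Re (z * w) =
  complex.Re z * complex.Re w - complex.Im z * complex.Im w.
Proof. by case: z; case: w. Qed.

Lemma cImM z w : complex.Im (z * w) =
  complex.Re z * complex.Im w + complex.Im z * complex.Re w.
Proof. by case: z; case: w. Qed.

Lemma cRe_conj z : complex.Re z^* = complex.Re z.
Proof. by rewrite conj_conjc; case: z. Qed.

Lemma cIm_conj z : complex.Im z^* = - complex.Im z.
Proof. by rewrite conj_conjc; case: z. Qed.

Lemma cmodulusE z :
  cmodulus z = Num.sqrt (complex.Re z ^+ 2 + complex.Im z ^+ 2).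
Proof. by rewrite /cmodulus normc_def. Qed.

Lemma cmodulusC z : (cmodulus z)%:C%C = `|z|.
Proof. by rewrite /cmodulus normc_def. Qed.

Lemma cmodulus_ge0 z : 0 <= cmodulus z.
Proof. by rewrite cmodulusE sqrtr_ge0. Qed.

Lemma cmodulus_sqr z :
  cmodulus z ^+ 2 = complex.Re z ^+ 2 + complex.Im z ^+ 2.
Proof. by rewrite cmodulusE sqr_sqrtr// addr_ge0// sqr_ge0. Qed.

Lemma Re_le_cmodulus z : `|complex.Re z| <= cmodulus z.
Proof.
by rewrite -sqrtr_sqr cmodulusE ler_wsqrtr// lerDl sqr_ge0.
Qed.

Lemma Im_le_cmodulus z : `|complex.Im z| <= cmodulus z.
Proof.
by rewrite -sqrtr_sqr cmodulusE ler_wsqrtr// lerDr sqr_ge0.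
Qed.

Lemma cmodulus_le z : cmodulus z <= `|complex.Re z| + `|complex.Im z|.
Proof.
rewrite -[leRHS]ger0_norm ?addr_ge0// -sqrtr_sqr cmodulusE ler_wsqrtr//.
rewrite sqrrD !real_normK ?num_real// lerD2r lerDl.
by rewrite mulrn_wge0// mulr_ge0.
Qed.

(** Reduces every complex limit below to two real ones. It rests on
    [|Re z|, |Im z| <= |z| <= |Re z| + |Im z|]. *)
Lemma cvg_complexP u (l : R[i]^o) : u @ \oo --> l <->
  ((complex.Re (u n)) @[n --> \oo] --> complex.Re l /\
   (complex.Im (u n)) @[n --> \oo] --> complex.Im l).
Proof.
split=> [ul|[ur ui]].
- split; apply/cvgrPdist_lt => e e0;
    have e0C : 0 < e%:C%C :> R[i] by rewrite ltcR.
  + move/cvgrPdist_lt : ul => /(_ _ e0C); apply: filterS => n.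
    rewrite -cReB -cmodulusC ltcR; apply: le_lt_trans.
    exact: Re_le_cmodulus.
  + move/cvgrPdist_lt : ul => /(_ _ e0C); apply: filterS => n.
    rewrite -cImB -cmodulusC ltcR; apply: le_lt_trans.
    exact: Im_le_cmodulus.
(* The norm takes values in [R[i]], so the radius is itself complex; its positivity forces the
   imaginary part [e'] to vanish. *)
- apply/cvgrPdist_lt => -[e e'] /[dup] e0; rewrite ltcE /= => /andP[/eqP -> {}e0].
  have e20 : 0 < e / 2 by rewrite divr_gt0.
  move/cvgrPdist_lt : ur => /(_ _ e20) ur.
  move/cvgrPdist_lt : ui => /(_ _ e20) ui.
  near=> n; rewrite -cmodulusC ltcR (le_lt_trans (cmodulus_le _))//.
  rewrite (splitr e) cReB cImB ltrD//.
    by near: n; exact: ur.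
  by near: n; exact: ui.
Unshelve. all: by end_near. Qed.

Lemma cvg_conj u (l : R[i]^o) : u @ \oo --> l ->
  (((u n)^* : R[i]^o) @[n --> \oo] --> (l^* : R[i]^o)).
Proof.
move=> /cvg_complexP[ur ui]; apply/cvg_complexP; split.
  by rewrite cRe_conj; under eq_fun do rewrite cRe_conj.
by rewrite cIm_conj; under eq_fun do rewrite cIm_conj; exact: cvgN.
Qed.

Lemma cvg_complexD u v (l m : R[i]^o) : u @ \oo --> l -> v @ \oo --> m ->
  ((u n + v n : R[i]^o) @[n --> \oo] --> (l + m : R[i]^o)).
Proof.
move=> /cvg_complexP[ur ui] /cvg_complexP[vr vi]; apply/cvg_complexP; split.
  by rewrite cReD; under eq_fun do rewrite cReD; exact: cvgD.
by rewrite cImD; under eq_fun do rewrite cImD; exact: cvgD.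
Qed.

Lemma cvg_complexZ (a : R[i]) u (l : R[i]^o) : u @ \oo --> l ->
  (((a * u n : R[i]) : R[i]^o) @[n --> \oo] --> ((a * l : R[i]) : R[i]^o)).
Proof.
move=> /cvg_complexP[ur ui]; apply/cvg_complexP; split.
  rewrite cReM; under eq_fun do rewrite cReM.
  by apply: cvgB; apply: cvgM => //; exact: cvg_cst.
rewrite cImM; under eq_fun do rewrite cImM.
by apply: cvgD; apply: cvgM => //; exact: cvg_cst.
Qed.

Lemma cvg_complex_sum k (u_ : 'I_k -> nat -> R[i]^o) (l : 'I_k -> R[i]^o) :
  (forall i, u_ i @ \oo --> l i) ->
  (((\sum_(i < k) u_ i n : R[i]^o)) @[n --> \oo] --> (\sum_(i < k) l i : R[i]^o)).
Proof.
elim: k u_ l => [|k IH] u_ l ul.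
  by rewrite big_ord0; under eq_fun do rewrite big_ord0; exact: cvg_cst.
rewrite big_ord_recl; under eq_fun do rewrite big_ord_recl.
by apply: cvg_complexD => //; apply: (IH (fun i => u_ (lift ord0 i))).
Qed.

(** In [R[i]], [0 <= z] means [Im z = 0] and [0 <= Re z]. The first condition survives because the
    imaginary parts are constantly zero, the second because real limits preserve weak
    inequalities. *)
Lemma limn_complex_ge0 u (l : R[i]^o) :
  u @ \oo --> l -> (forall n, (0 : R[i]) <= u n) -> (0 : R[i]) <= l.
Proof.
move=> /cvg_complexP[ur ui] u0; rewrite lecE /=; apply/andP; split.
  rewrite -(cvg_lim _ ui)//; apply/eqP/cvg_lim => //.
  under eq_fun => n.
    have := u0 n; rewrite lecE /= => /andP[/eqP -> _]; over.
  exact: cvg_cst.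
rewrite -(cvg_lim _ ur)//; apply: limr_ge.
  by apply/cvg_ex; eexists; exact: ur.
by apply: nearW => n; have := u0 n; rewrite lecE /= => /andP[].
Qed.

Lemma cvg_cmodulus u (l : R[i]^o) : u @ \oo --> l ->
  cmodulus (u n) @[n --> \oo] --> cmodulus l.
Proof.
move=> /cvg_complexP[ur ui].
under eq_fun do rewrite cmodulusE; rewrite cmodulusE.
apply: continuous_cvg; first exact: sqrt_continuous.
by apply: cvgD; apply: cvgM.
Qed.

End ComplexSequences.

(** * Topology and Borel measurability of translations *)

Section Translation.
Context {G : topologicalZmodType}.
Implicit Types (t : G) (A : set G).

Lemma shift_continuous t : continuous (fun x : G => x + t).
Proof.
move=> x; apply: (@continuous_comp _ _ _ (fun y => (y, t)) (fun z => z.1 + z.2)).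
  by apply: cvg_pair; [exact: cvg_id|exact: cvg_cst].
exact: add_continuous.
Qed.

Lemma open_shift t A : open A -> open [set x | A (x + t)].
Proof. exact: (proj1 (continuousP _) (@shift_continuous t)). Qed.

Lemma closed_shift t A : closed A -> closed [set x | A (x + t)].
Proof.
move=> cA; rewrite -openC; apply: (@open_shift t (~` A)).
by rewrite openC.
Qed.

(** Together with [image_subr], turns the sumsets in [hove_boundary [set t] A] into preimages under
    translations. *)
Lemma image_addr t A : [set x + y | x in A & y in [set t]] = [set x | A (x - t)].
Proof.
apply/seteqP; split=> [_ [x Ax [_ -> <-]]|x Ax] /=; first by rewrite addrK.
by exists (x - t) => //; exists t => //; rewrite subrK.
Qed.

Lemma image_subr t A : [set x - y | x in A & y in [set t]] = [set x | A (x + t)].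
Proof.
apply/seteqP; split=> [_ [x Ax [_ -> <-]]|x Ax] /=; first by rewrite subrK.
by exists (x + t) => //; exists t => //; rewrite addrK.
Qed.

Lemma borel_open A : open A -> measurable (A : set (borel G)).
Proof. by move=> oA; exact: sub_sigma_algebra. Qed.

Lemma borel_closed A : closed A -> measurable (A : set (borel G)).
Proof.
move=> cA; rewrite -[A]setCK; apply: measurableC; apply: borel_open.
by rewrite openC.
Qed.

Lemma measurable_shift t :
  measurable_fun [set: borel G] ((fun x : G => x + t) : borel G -> borel G).
Proof.
apply: (@measurability _ _ (borel G) (borel G) setT (fun x : G => x + t)
  (@open G) erefl).
move=> _ [U oU <-]; rewrite setTI; apply: borel_open; exact: open_shift.
Qed.

Lemma compact_shift t A : compact A -> compact [set x | A (x + t)].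
Proof.
move=> cA; rewrite (_ : mkset _ = (fun x => x - t) @` A); last first.
  apply/seteqP; split=> [x Ax|_ [x Ax <-]]; last by rewrite /= subrK.
  by exists (x + t) => //; rewrite addrK.
apply: continuous_compact => //.
by apply: continuous_subspaceT => x; exact: shift_continuous.
Qed.

End Translation.

(* The library's hint for this filter does not fire at the type [borel G]. *)
#[global] Instance ae_borel_filter (R : realType) (G : topologicalZmodType)
  (mu : {measure set (borel G) -> \bar R}) : Filter (nbhs (almost_everywhere mu)).
Proof. exact: ae_filter_ringOfSetsType. Qed.

(** * Real essentially bounded functions and the asymptotic translation invariance of their means *)

Section EssentiallyBounded.
Context {R : realType} {G : topologicalZmodType}.
Variable mu : {measure set (borel G) -> \bar R}.
Hypothesis hausG : hausdorff_space G.
Hypothesis haar_mu : haar_measure mu.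
Implicit Types (F H : G -> R) (B : set (borel G)) (t : G).

Lemma measure_shift t B : measurable B -> mu [set x | B (x + t)] = mu B.
Proof.
move=> mB; rewrite -(haar_invariant haar_mu (- t) mB); congr (mu _).
apply/seteqP; split=> [x Bx|_ [x Bx <-]] /=.
  by exists (x + t) => //; rewrite addrCA addNr addr0.
by rewrite addrAC addNr add0r.
Qed.

Lemma precompact_lty (A : set G) : precompact A -> open A ->
  (mu (A : set (borel G)) < +oo)%E.
Proof.
rewrite precompactE => cA oA.
apply: le_lt_trans (haar_compact haar_mu cA).
apply: le_measure; rewrite ?inE.
- exact: borel_open.
- by apply: borel_closed; exact: closed_closure.
- exact: subset_closure.
Qed.

Definition ess_bounded F := measurable_fun [set: borel G] F /\
  exists M : R, {ae mu, forall x, `|F x| <= M}.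

Lemma ess_bounded_cst (r : R) : ess_bounded (fun=> r).
Proof. by split; [exact: measurable_cst|exists `|r|; exact/aeW]. Qed.

Lemma ess_boundedD F H : ess_bounded F -> ess_bounded H ->
  ess_bounded (fun x => F x + H x).
Proof.
move=> [mF [M FM]] [mH [N HN]]; split; first exact: measurable_funD.
exists (M + N); apply: filterS2 FM HN => x FM HN.
by rewrite (le_trans (ler_normD _ _))// lerD.
Qed.

Lemma ess_boundedM F H : ess_bounded F -> ess_bounded H ->
  ess_bounded (fun x => F x * H x).
Proof.
move=> [mF [M FM]] [mH [N HN]]; split; first exact: measurable_funM.
by exists (M * N); apply: filterS2 FM HN => x FM HN; rewrite normrM ler_pM.
Qed.

Lemma ess_boundedN F : ess_bounded F -> ess_bounded (fun x => - F x).
Proof.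
move=> [mF [M FM]]; split; first exact: measurableT_comp.
by exists M; apply: filterS FM => x; rewrite normrN.
Qed.

(** The exceptional null set moves to a translate, which is null by invariance of [mu]. *)
Lemma ess_bounded_shift t F : ess_bounded F -> ess_bounded (fun x => F (x + t)).
Proof.
move=> [mF [M [N [mN N0 FN]]]]; split.
  exact: (measurableT_comp mF (measurable_shift t)).
exists M; exists [set x | N (x + t)]; split.
- by rewrite -[X in measurable X]setTI; exact: (measurable_shift t).
- by rewrite measure_shift.
- by move=> x /= FM; apply: FN.
Qed.

Lemma ess_bounded_integrable F B : measurable B -> (mu B < +oo)%E ->
  ess_bounded F -> mu.-integrable B (EFin \o F).
Proof.
move=> mB Boo [mF [M FM]]; apply/integrableP; split.
  by apply/measurable_EFinP; apply: measurable_funS mF.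
have mFB : measurable_fun B (EFin \o F).
  by apply/measurable_EFinP; apply: measurable_funS mF.
(* [M] carries no sign information; its absolute value is a nonnegative dominating constant. *)
pose N : R := `|M|.
apply: (@le_lt_trans _ _ (\int[mu]_(x in B) N%:E)%E).
  apply: ae_ge0_le_integral => //.
  - exact: measurableT_comp.
  - by move=> x _; rewrite lee_fin normr_ge0.
  - by apply: filterS FM => x FM _; rewrite lee_fin (le_trans FM)// ler_norm.
by rewrite integral_cst// lte_mul_pinfty// lee_fin normr_ge0.
Qed.

Lemma normr_Rintegral_le F (M : R) B : measurable B -> (mu B < +oo)%E ->
  measurable_fun [set: borel G] F -> {ae mu, forall x, `|F x| <= M} -> 0 <= M ->
  `|\int[mu]_(x in B) F x| <= M * fine (mu B).
Proof.
move=> mB Boo mF FM M0.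
have iF : mu.-integrable B (EFin \o F).
  by apply: ess_bounded_integrable => //; split => //; exists M.
apply: (le_trans (le_normr_Rintegral mB iF)).
rewrite -(Rintegral_cst mu mB M); apply: fine_le.
- rewrite ge0_fin_numE; first by have [] := integrableP _ _ _ iF.
  by apply: integral_ge0.
- rewrite integral_cst// ge0_fin_numE ?lte_mul_pinfty ?lee_fin//.
  by rewrite mule_ge0 ?lee_fin.
- have mFB : measurable_fun B F by apply: measurable_funS mF.
  apply: ae_ge0_le_integral => //.
  + by apply/measurable_EFinP; exact: measurableT_comp.
  + by apply: filterS FM => x FM _; rewrite lee_fin.
Qed.

(** By invariance, [mu] is its own image under [x - t], so this is the change of variables formula
    for a pushforward. Boundedness on a set of finite measure supplies the integrability that the
    formula asks for. *)
Lemma Rintegral_shift t F B : measurable B -> (mu B < +oo)%E -> ess_bounded F ->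
  \int[mu]_(x in B) F (x - t) = \int[mu]_(x in [set x | B (x + t)]) F x.
Proof.
move=> mB Boo bF; congr fine; set Bt : set (borel G) := [set x | _].
have mBt : measurable Bt.
  by rewrite -[X in measurable X]setTI; exact: (measurable_shift t).
have mF : measurable_fun [set: borel G] (EFin \o F).
  by apply/measurable_EFinP; case: bF.
pose phi : borel G -> borel G := fun x : G => x - t.
have mphi : measurable_fun [set: borel G] phi by exact: measurable_shift.
have BtK : phi @^-1` Bt = B.
  by apply/seteqP; split=> x; rewrite /Bt /phi /= subrK.
transitivity (\int[pushforward mu phi]_(y in Bt) (EFin \o F) y)%E;
    last first.
  apply: eq_measure_integral => C mC _.
  exact: (measure_shift (- t) mC).
rewrite (integral_pushforward mphi mF)//.
- by rewrite BtK.
- rewrite BtK; apply: ess_bounded_integrable => //.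
  exact: ess_bounded_shift.
Qed.

Lemma hove_boundary_measurable t (A : set G) : open A ->
  measurable (hove_boundary [set t] A : set (borel G)).
Proof.
move=> oA; apply: measurableU.
  apply: measurableD; last exact: borel_open.
  by apply: borel_closed; exact: closed_closure.
apply: measurableI; last by apply: borel_closed; exact: closed_closure.
apply: borel_closed; rewrite image_subr; apply: (@closed_shift _ t (~` A)).
exact: open_closedC.
Qed.

(** The boundary lies in the union of the compact sets [closure A + t] and [closure A]. Finiteness
    is what allows inequalities between measures to pass through [fine]. *)
Lemma hove_boundary_lty t (A : set G) : open A -> precompact A ->
  (mu (hove_boundary [set t] A : set (borel G)) < +oo)%E.
Proof.
move=> oA; rewrite precompactE => cA.
have cAt : compact [set x | closure A (x - t)] by exact: (@compact_shift _ (- t)).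
have mclA : measurable (closure A : set (borel G)).
  by apply: borel_closed; exact: closed_closure.
have mAt : measurable ([set x | closure A (x - t)] : set (borel G)).
  by apply: borel_closed; exact: compact_closed.
apply: (@le_lt_trans _ _ (mu (([set x | closure A (x - t)] : set (borel G))
                               `|` closure A))).
  apply: le_measure; rewrite ?inE.
  - exact: hove_boundary_measurable.
  - exact: measurableU.
  - apply: setUSS => [x [+ _]|x []//]; rewrite image_addr => h.
    have : closed [set x | closure A (x - t)] by exact: compact_closed.
    rewrite closure_id => ->; apply: closure_subset h => y /=.
    exact: subset_closure.
apply: le_lt_trans (measureU2 _ _ _) _ => //.
by apply: lte_add_pinfty; exact: (haar_compact haar_mu).
Qed.

Variable A : nat -> set G.
Hypothesis vhA : van_hove mu A.
Local Notation vol n := (fine (mu (A n : set (borel G)))).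

Let mA n : measurable (A n : set (borel G)).
Proof. by apply: borel_open; exact: (van_hove_open vhA). Qed.

Let Aoo n : (mu (A n : set (borel G)) < +oo)%E.
Proof.
by apply: precompact_lty; [exact: (van_hove_precompact vhA)|exact: (van_hove_open vhA)].
Qed.

Lemma vol_gt0 n : 0 < vol n.
Proof. by rewrite fine_gt0// (van_hove_gt0 vhA) Aoo. Qed.

(* [A n] and its translate by [- t] differ by a part of the van Hove
   boundaries for the compact sets [{t}] and [{- t}]. *)
Lemma mean_shift_cvg0 t F : ess_bounded F ->
  (vol n)^-1 * \int[mu]_(x in A n) F (x - t)
    - (vol n)^-1 * \int[mu]_(x in A n) F x @[n --> \oo] --> (0 : R).
Proof.
move=> bF; have [mF [M0 FM0]] := bF.
pose M := `|M0|.
have FM : {ae mu, forall x, `|F x| <= M}.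
  by apply: filterS FM0 => x /le_trans; apply; exact: ler_norm.
pose d s n := fine (mu (hove_boundary [set s] (A n))).
have cvgd s : d s n / vol n @[n --> \oo] --> (0 : R).
  exact: (van_hove_boundary vhA (@compact_set1 _ s)).
apply/norm_cvg0P.
have cvgM : M * (d (- t) n / vol n + d t n / vol n) @[n --> \oo] --> (0 : R).
  rewrite -(mulr0 M) -[X in _ * X](addr0 0).
  by apply: cvgM; [exact: cvg_cst|apply: cvgD].
apply: (squeeze_cvgr _ (cvg_cst 0) cvgM).
apply: nearW => n; rewrite normr_ge0/=.
(* The shift moves from the integrand to the domain, so that one function is integrated over the two
   sets [At] and [A n]. *)
rewrite Rintegral_shift//; set At := [set x | A n (x + t)].
have mAt : measurable (At : set (borel G)).
  by rewrite -[X in measurable X]setTI; exact: (measurable_shift t).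
have Atoo : (mu (At : set (borel G)) < +oo)%E.
  by rewrite measure_shift.
have split_int (B C : set (borel G)) : measurable B -> measurable C ->
    (mu B < +oo)%E ->
    \int[mu]_(x in B) F x
      = \int[mu]_(x in B `\` C) F x + \int[mu]_(x in B `&` C) F x.
  move=> mB mC Boo; rewrite -Rintegral_setU.
  - by rewrite setUC setUIDK.
  - exact: measurableD.
  - exact: measurableI.
  - by rewrite setUC setUIDK; exact: ess_bounded_integrable.
  - by apply/disj_setPS => x [[_ nCx] [_ Cx]]; exact: nCx.
have bound (B : set (borel G)) s : measurable B ->
    B `<=` hove_boundary [set s] (A n) ->
    `|\int[mu]_(x in B) F x| <= M * d s n.
  move=> mB Bs; have mH := hove_boundary_measurable s (van_hove_open vhA n).
  have Hoo := hove_boundary_lty s (van_hove_open vhA n) (van_hove_precompact vhA n).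
  have BH : (mu B <= mu (hove_boundary [set s] (A n) : set (borel G)))%E.
    by apply: le_measure; rewrite ?inE.
  have Boo := le_lt_trans BH Hoo.
  apply: (le_trans (normr_Rintegral_le mB Boo mF FM _)); first exact: normr_ge0.
  by rewrite ler_wpM2l ?normr_ge0//; apply: fine_le => //; rewrite ge0_fin_numE.
(* The integrals over the common part cancel. What remains of [At] outside [A n] lies in the first
   half of the boundary for [- t]; what remains of [A n] outside [At] lies in the second half of the
   boundary for [t]. *)
rewrite (split_int _ _ mAt (mA n) Atoo) (split_int _ _ (mA n) mAt (Aoo n)).
rewrite (setIC (A n)) -mulrBr opprD addrACA subrr addr0.
rewrite normrM ger0_norm ?invr_ge0 ?fine_ge0// mulrC -mulrDl mulrA.
rewrite ler_wpM2r ?invr_ge0 ?fine_ge0//.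
rewrite (le_trans (ler_normB _ _))// mulrDr lerD//; apply: bound.
- exact: measurableD.
- move=> x [/= Ax nAx]; left; split => //; apply: subset_closure.
  by rewrite image_addr /= opprK.
- exact: measurableD.
- move=> x [/= Ax nAx]; right; split; last exact: subset_closure.
  by rewrite image_subr.
Qed.

End EssentiallyBounded.

(** * Means of complex functions over one set, up to the Cauchy-Schwarz inequality *)

Section ComplexMean.
Context {R : realType} {G : topologicalZmodType}.
Variable mu : {measure set (borel G) -> \bar R}.
Hypothesis haar_mu : haar_measure mu.
Implicit Types (P Q f g : G -> R[i]) (B : set (borel G)) (t : G).

Lemma LinftyP f : Linfty mu f <->
  ess_bounded mu (fun x => complex.Re (f x)) /\
  ess_bounded mu (fun x => complex.Im (f x)).
Proof.
split=> [[mr mi [M fM]]|[[mr [M fM]] [mi [N fN]]]].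
  split; split=> //; exists M; apply: filterS fM => x; apply: le_trans.
    exact: Re_le_cmodulus.
  exact: Im_le_cmodulus.
split=> //; exists (M + N); apply: filterS2 fM fN => x fM fN.
by rewrite (le_trans (cmodulus_le _))// lerD.
Qed.

Lemma Linfty_cst (z : R[i]) : Linfty mu (fun=> z).
Proof. by apply/LinftyP; split; exact: ess_bounded_cst. Qed.

Lemma LinftyD f g : Linfty mu f -> Linfty mu g -> Linfty mu (fun x => f x + g x).
Proof.
move=> /LinftyP[fr fi] /LinftyP[gr gi]; apply/LinftyP; split.
  under eq_fun do rewrite cReD; exact: ess_boundedD.
under eq_fun do rewrite cImD; exact: ess_boundedD.
Qed.

Lemma LinftyM f g : Linfty mu f -> Linfty mu g -> Linfty mu (fun x => f x * g x).
Proof.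
move=> /LinftyP[fr fi] /LinftyP[gr gi]; apply/LinftyP; split.
  under eq_fun do rewrite cReM.
  apply: ess_boundedD; first exact: ess_boundedM.
  by apply: ess_boundedN; exact: ess_boundedM.
under eq_fun do rewrite cImM.
by apply: ess_boundedD; exact: ess_boundedM.
Qed.

Lemma Linfty_conj f : Linfty mu f -> Linfty mu (fun x => (f x)^*).
Proof.
move=> /LinftyP[fr fi]; apply/LinftyP; split.
  by under eq_fun do rewrite cRe_conj.
under eq_fun do rewrite cIm_conj; exact: ess_boundedN.
Qed.

Lemma Linfty_shift t f : Linfty mu f -> Linfty mu (fun x => f (x + t)).
Proof.
move=> /LinftyP[fr fi]; apply/LinftyP; split.
  exact: (ess_bounded_shift haar_mu t fr).
exact: (ess_bounded_shift haar_mu t fi).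
Qed.

Lemma Linfty_sum n (F : 'I_n -> G -> R[i]) :
  (forall i, Linfty mu (F i)) -> Linfty mu (fun x => \sum_(i < n) F i x).
Proof.
elim: n F => [|n IH] F bF.
  by under eq_fun do rewrite big_ord0; exact: Linfty_cst.
under eq_fun do rewrite big_ord_recl.
by apply: LinftyD => //; exact: IH.
Qed.

(** With [B = A n] and the correlation of [f] and [g] as integrand, this is convertible to
    [eberlein_mean]. *)
Definition cmean B P : R[i] := ((fine (mu B))^-1)%:C%C * Cintegral mu B P.

Lemma Re_cmean B P : complex.Re (cmean B P) =
  (fine (mu B))^-1 * \int[mu]_(x in B) complex.Re (P x).
Proof. by rewrite cReM /= mul0r subr0. Qed.

Lemma Im_cmean B P : complex.Im (cmean B P) =
  (fine (mu B))^-1 * \int[mu]_(x in B) complex.Im (P x).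
Proof. by rewrite cImM /= mul0r addr0. Qed.

Lemma cmean_conj B P : Linfty mu P -> measurable B -> (mu B < +oo)%E ->
  cmean B (fun x => (P x)^*) = (cmean B P)^*.
Proof.
move=> /LinftyP[Pr Pi] mB Boo; apply: eq_ReIm.
  rewrite cRe_conj !Re_cmean; congr (_ * _).
  by apply: eq_Rintegral => x _; rewrite cRe_conj.
rewrite cIm_conj !Im_cmean -mulrN; congr (_ * _).
rewrite -mulN1r -RintegralZl//; last exact: (ess_bounded_integrable mB Boo Pi).
by apply: eq_Rintegral => x _; rewrite cIm_conj mulN1r.
Qed.

Lemma cmean_ge0 B P : (forall x, 0 <= P x) -> 0 <= cmean B P.
Proof.
move=> P0; have PE x : complex.Im (P x) = 0 /\ 0 <= complex.Re (P x).
  by have := P0 x; rewrite lecE /= => /andP[/eqP -> ->].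
rewrite lecE Re_cmean Im_cmean /=; apply/andP; split.
  rewrite (@eq_Rintegral _ _ _ _ _ (fun=> 0)); last by move=> x _; case: (PE x).
  by rewrite /Rintegral integral0 mulr0.
apply: mulr_ge0; first by rewrite invr_ge0 fine_ge0.
by apply: Rintegral_ge0 => x _; case: (PE x).
Qed.

Section FiniteMeasure.
Variable B : set (borel G).
Hypotheses (mB : measurable B) (Boo : (mu B < +oo)%E).

Lemma cmeanD P Q : Linfty mu P -> Linfty mu Q ->
  cmean B (fun x => P x + Q x) = cmean B P + cmean B Q.
Proof.
move=> /LinftyP[Pr Pi] /LinftyP[Qr Qi]; apply: eq_ReIm.
  rewrite cReD !Re_cmean -mulrDr -RintegralD//; last 2 first.
  - exact: (ess_bounded_integrable mB Boo Pr).
  - exact: (ess_bounded_integrable mB Boo Qr).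
  by congr (_ * _); apply: eq_Rintegral => x _; rewrite cReD.
rewrite cImD !Im_cmean -mulrDr -RintegralD//; last 2 first.
- exact: (ess_bounded_integrable mB Boo Pi).
- exact: (ess_bounded_integrable mB Boo Qi).
by congr (_ * _); apply: eq_Rintegral => x _; rewrite cImD.
Qed.

Lemma cmeanZ (a : R[i]) P : Linfty mu P ->
  cmean B (fun x => a * P x) = a * cmean B P.
Proof.
move=> /LinftyP[Pr Pi].
have scal (r : R) F : ess_bounded mu F ->
    mu.-integrable B (EFin \o (fun x => r * F x)).
  move=> bF; apply: ess_bounded_integrable => //; apply: ess_boundedM => //.
  exact: ess_bounded_cst.
have scalE (r : R) F : ess_bounded mu F ->
    \int[mu]_(x in B) (r * F x) = r * \int[mu]_(x in B) F x.
  by move=> bF; rewrite RintegralZl//; exact: (ess_bounded_integrable mB Boo bF).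
apply: eq_ReIm.
  rewrite [complex.Re (a * _)]cReM !Re_cmean Im_cmean mulrCA.
  rewrite (mulrCA (complex.Im a)) -mulrBr.
  congr (_ * _); rewrite -!scalE// -RintegralB//; [|exact: scal..].
  by apply: eq_Rintegral => x _; rewrite cReM.
rewrite [complex.Im (a * _)]cImM !Im_cmean Re_cmean mulrCA.
rewrite (mulrCA (complex.Im a)) -mulrDr.
congr (_ * _); rewrite -!scalE// -RintegralD//; [|exact: scal..].
by apply: eq_Rintegral => x _; rewrite cImM.
Qed.

Lemma cmean_sum n (F : 'I_n -> G -> R[i]) : (forall i, Linfty mu (F i)) ->
  cmean B (fun x => \sum_(i < n) F i x) = \sum_(i < n) cmean B (F i).
Proof.
elim: n F => [|n IH] F bF.
  rewrite big_ord0; transitivity (0 * cmean B (fun=> 0)); last by rewrite mul0r.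
  rewrite -cmeanZ; last exact: Linfty_cst.
  by congr cmean; apply/funext => x; rewrite big_ord0 mul0r.
rewrite big_ord_recl -IH// -cmeanD//; last exact: Linfty_sum.
by congr cmean; apply/funext => x; rewrite big_ord_recl.
Qed.

Lemma Re_cmean_ge0 f : 0 <= complex.Re (cmean B (fun x => f x * (f x)^*)).
Proof.
suff: 0 <= cmean B (fun x => f x * (f x)^*) by rewrite lecE => /andP[].
by apply: cmean_ge0 => x; rewrite mul_conjC_ge0.
Qed.

(** For [b > 0] the value [r = 1 / b] minimises the quadratic and gives [0 <= a - c / b]. For
    [b = 0] the form is affine in [r] and can stay nonnegative only if [c = 0]. *)
Lemma le_discr_of_quadratic_ge0 (a b c : R) : 0 <= b -> 0 <= c ->
  (forall r, 0 <= a - 2 * r * c + r ^+ 2 * c * b) -> c <= a * b.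
Proof.
rewrite le_eqVlt => /predU1P[<-|b0] c0 q.
  (* If [c > 0], this [r] makes the affine form equal to [a - (a + 1) = -1]. *)
  rewrite mulr0 leNgt; apply/negP => {}c0; have := q ((a + 1) / (2 * c)).
  have -> : 2 * ((a + 1) / (2 * c)) * c = a + 1 by field; rewrite gt_eqF.
  lra.
have := q b^-1; have -> : 2 * b^-1 * c = 2 * (c / b) by ring.
have -> : b^-1 ^+ 2 * c * b = c / b by field; rewrite gt_eqF.
move=> h; rewrite -ler_pdivrMr//; lra.
Qed.

(** The choice [l = r * c] aligns phases: both cross terms become the real number [- r * |c| ^+ 2],
    leaving a real quadratic in [r]. *)
Lemma Re_quadratic (a b c : R[i]) (r : R) : complex.Im b = 0 ->
  let l := r%:C%C * c in
  complex.Re (a + (- l^* * c + (- l * c^* + l * l^* * b))) =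
  complex.Re a - 2 * r * cmodulus c ^+ 2
    + r ^+ 2 * cmodulus c ^+ 2 * complex.Re b.
Proof.
move=> b0 l; rewrite /l cmodulus_sqr !conj_conjc.
by case: a b b0 c {l} => a1 a2 [b1 b2] /= -> [c1 c2] /=; ring.
Qed.

(** This is the expanded mean of [(f - l * g) * (f - l * g)^*], a pointwise nonnegative function. *)
Lemma cmean_sesquilinear_ge0 f g (l : R[i]) : Linfty mu f -> Linfty mu g ->
  0 <= cmean B (fun x => f x * (f x)^*)
       + (- l^* * cmean B (fun x => f x * (g x)^*)
          + (- l * (cmean B (fun x => f x * (g x)^*))^*
             + l * l^* * cmean B (fun x => g x * (g x)^*))).
Proof.
move=> bf bg; set c := cmean B (fun x => f x * (g x)^*).
have bfc := Linfty_conj bf; have bgc := Linfty_conj bg.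
have bb := LinftyM bg bgc; have bc := LinftyM bf bgc.
have bd := LinftyM bg bfc; have ba := LinftyM bf bfc.
have bZ z P : Linfty mu P -> Linfty mu (fun x => z * P x).
  by move=> bP; apply: LinftyM => //; exact: Linfty_cst.
have -> : c^* = cmean B (fun x => g x * (f x)^*).
  rewrite -cmean_conj//; congr cmean; apply/funext => x.
  by rewrite rmorphM /= conjCK mulrC.
rewrite -!cmeanZ// -!cmeanD//.
  apply: cmean_ge0 => x.
  rewrite (_ : _ + _ = (f x - l * g x) * (f x - l * g x)^*) ?mul_conjC_ge0//.
  by rewrite rmorphB rmorphM /=; ring.
all: by repeat first [assumption | apply: LinftyD | apply: bZ].
Qed.

Lemma cmean_Cauchy_Schwarz f g : Linfty mu f -> Linfty mu g ->
  cmodulus (cmean B (fun x => f x * (g x)^*)) ^+ 2 <=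
  complex.Re (cmean B (fun x => f x * (f x)^*)) *
  complex.Re (cmean B (fun x => g x * (g x)^*)).
Proof.
move=> bf bg; apply: le_discr_of_quadratic_ge0 => [||r];
  [exact: Re_cmean_ge0|exact: sqr_ge0|].
rewrite -Re_quadratic; last first.
  apply: ger0_Im; apply: cmean_ge0 => x; exact: mul_conjC_ge0.
have := cmean_sesquilinear_ge0
  (r%:C%C * cmean B (fun x => f x * (g x)^*)) bf bg.
by rewrite lecE => /andP[].
Qed.

End FiniteMeasure.

End ComplexMean.

(** * Limits along the van Hove sequence and the properties of the convolution *)

Section VanHoveMean.
Context {R : realType} {G : topologicalZmodType}.
Variables (mu : {measure set (borel G) -> \bar R}) (A : nat -> set G).
Hypothesis hausG : hausdorff_space G.
Hypothesis haar_mu : haar_measure mu.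
Hypothesis vhA : van_hove mu A.
Implicit Types (P f g : G -> R[i]) (t : G).

Lemma van_hove_measurable n : measurable (A n : set (borel G)).
Proof. by apply: borel_open; exact: (van_hove_open vhA). Qed.

Lemma van_hove_lty n : (mu (A n : set (borel G)) < +oo)%E.
Proof.
apply: precompact_lty => //; first exact: (van_hove_precompact vhA).
exact: (van_hove_open vhA).
Qed.

Lemma eberlein_meanE f g t :
  eberlein_mean mu A f g t =
  (fun n => cmean mu (A n) (fun s => f s * (g (s - t))^*)).
Proof. by []. Qed.

Lemma eberlein_cvg f g t : eberlein_exists mu A f g ->
  eberlein_mean mu A f g t @ \oo --> (eberlein mu A f g t : R[i]^o).
Proof. by move=> /(_ t). Qed.

Lemma eberlein_eq f g t (l : R[i]^o) :
  eberlein_mean mu A f g t @ \oo --> l -> eberlein mu A f g t = l.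
Proof. by move=> h; apply: cvg_lim h; exact: norm_hausdorff. Qed.

Lemma Linfty_correlation f g t : Linfty mu f -> Linfty mu g ->
  Linfty mu (fun s => f s * (g (s - t))^*).
Proof.
move=> bf bg; apply: LinftyM => //; apply: Linfty_conj.
exact: (Linfty_shift haar_mu (- t) bg).
Qed.

(** Convergence of the translated means is a conclusion here, so the existence of translated or
    reflected convolutions follows from that of the original one. *)
Lemma cmean_shift_cvg t P (l : R[i]^o) : Linfty mu P ->
  (cmean mu (A n) P : R[i]^o) @[n --> \oo] --> l ->
  (cmean mu (A n) (fun x => P (x - t)) : R[i]^o) @[n --> \oo] --> l.
Proof.
move=> /LinftyP[Pr Pi] /cvg_complexP[lr li]; apply/cvg_complexP; split.
  apply: cvg_sub0 lr.
  rewrite [X in X @ _](_ : _ = (fun n => (fine (mu (A n)))^-1 *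
      \int[mu]_(x in A n) complex.Re (P (x - t))
    - (fine (mu (A n)))^-1 * \int[mu]_(x in A n) complex.Re (P x))); last first.
    by apply/funext => n; rewrite -!Re_cmean.
  exact: (mean_shift_cvg0 hausG haar_mu vhA t Pr).
apply: cvg_sub0 li.
rewrite [X in X @ _](_ : _ = (fun n => (fine (mu (A n)))^-1 *
    \int[mu]_(x in A n) complex.Im (P (x - t))
  - (fine (mu (A n)))^-1 * \int[mu]_(x in A n) complex.Im (P x))); last first.
  by apply/funext => n; rewrite -!Im_cmean.
exact: (mean_shift_cvg0 hausG haar_mu vhA t Pi).
Qed.

Lemma eberlein_shift_cvg f g t s : Linfty mu f -> Linfty mu g ->
  eberlein_exists mu A f g ->
  eberlein_mean mu A (translate t f) (translate t g) s @ \oo -->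
    (eberlein mu A f g s : R[i]^o).
Proof.
move=> bf bg fg; have h := @eberlein_cvg f g s fg.
suff -> : eberlein_mean mu A (translate t f) (translate t g) s =
    (fun n => cmean mu (A n) (fun x => f (x - t) * (g (x - t - s))^*)).
  exact: (@cmean_shift_cvg t _ _ (Linfty_correlation s bf bg) h).
apply/funext => n; congr cmean; apply/funext => x.
by rewrite /translate addrAC.
Qed.

(** An exact identity of the means at each [n]: the integrands coincide, as
    [x - (s - t) - t = x - s]. *)
Lemma eberlein_translater f g t s :
  eberlein_mean mu A f (translate t g) (s - t) = eberlein_mean mu A f g s.
Proof.
rewrite !eberlein_meanE; apply/funext => n; congr cmean; apply/funext => x.
by rewrite /translate opprB addrA addrAC addrK.
Qed.

(** The integrand [g x * (f (x - t))^*] is the conjugate of the translate by [t] of the integrand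
    that defines [[f, g](- t)]. *)
Lemma eberlein_conj f g : Linfty mu f -> Linfty mu g ->
  eberlein_exists mu A f g ->
  eberlein mu A g f = conj_reflect (eberlein mu A f g).
Proof.
move=> bf bg fg; apply/funext => t; apply: eberlein_eq.
have h := @eberlein_cvg f g (- t) fg.
suff -> : eberlein_mean mu A g f t = (fun n =>
    (cmean mu (A n) (fun s => f (s - t) * (g (s - t - - t))^*))^*).
  exact: (cvg_conj (@cmean_shift_cvg t _ _ (Linfty_correlation (- t) bf bg) h)).
apply/funext => n; rewrite -cmean_conj//; last 3 first.
- exact: (Linfty_shift haar_mu (- t) (Linfty_correlation (- t) bf bg)).
- exact: van_hove_measurable.
- exact: van_hove_lty.
congr cmean; apply/funext => x.
by rewrite rmorphM /= conjCK opprK subrK mulrC.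
Qed.

Lemma eberlein_linearl f g h (a b : R[i]) :
  Linfty mu f -> Linfty mu g -> Linfty mu h ->
  eberlein_exists mu A f g -> eberlein_exists mu A h g ->
  eberlein mu A (fun x => a * f x + b * h x) g
    = (fun t => a * eberlein mu A f g t + b * eberlein mu A h g t).
Proof.
move=> bf bg bh fg hg; apply/funext => t.
have {}fg := @eberlein_cvg f g t fg; have {}hg := @eberlein_cvg h g t hg.
apply: eberlein_eq; rewrite eberlein_meanE.
rewrite (_ : (fun n => _) = (fun n => a * eberlein_mean mu A f g t n
    + b * eberlein_mean mu A h g t n)).
  by apply: cvg_complexD; exact: cvg_complexZ.
apply/funext => n; rewrite !eberlein_meanE.
have mA := van_hove_measurable n; have Aoo := van_hove_lty n.
have bfg := Linfty_correlation t bf bg; have bhg := Linfty_correlation t bh bg.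
rewrite -!cmeanZ// -cmeanD//; [|by apply: LinftyM => //; exact: Linfty_cst..].
by congr cmean; apply/funext => x; rewrite mulrDl !mulrA.
Qed.

Lemma eberlein_linearr f g h (a b : R[i]) :
  Linfty mu f -> Linfty mu g -> Linfty mu h ->
  eberlein_exists mu A f g -> eberlein_exists mu A f h ->
  eberlein mu A f (fun x => a * g x + b * h x)
    = (fun t => a^* * eberlein mu A f g t + b^* * eberlein mu A f h t).
Proof.
move=> bf bg bh fg fh; apply/funext => t.
have {}fg := @eberlein_cvg f g t fg; have {}fh := @eberlein_cvg f h t fh.
apply: eberlein_eq; rewrite eberlein_meanE.
rewrite (_ : (fun n => _) = (fun n => a^* * eberlein_mean mu A f g t n
    + b^* * eberlein_mean mu A f h t n)).
  by apply: cvg_complexD; exact: cvg_complexZ.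
apply/funext => n; rewrite !eberlein_meanE.
have mA := van_hove_measurable n; have Aoo := van_hove_lty n.
have bfg := Linfty_correlation t bf bg; have bfh := Linfty_correlation t bf bh.
rewrite -!cmeanZ// -cmeanD//; [|by apply: LinftyM => //; exact: Linfty_cst..].
congr cmean; apply/funext => x.
by rewrite rmorphD !rmorphM /= mulrDr !(mulrCA (f x)).
Qed.

(* Translating by [- x i] turns the mean defining the [(i, j)] entry into the
   mean of [f (s + x i) * (f (s + x j))^*], so that the quadratic form is the
   limit of the means of [`|\sum_i c i * f (s + x i)| ^+ 2]. *)
Lemma eberlein_positive_definite f : Linfty mu f -> eberlein_exists mu A f f ->
  positive_definite (eberlein mu A f f).
Proof.
move=> bf ff n x c.
pose S s := \sum_(i < n) c i * f (s + x i).
have bfx i : Linfty mu (fun s => f (s + x i)) by exact: (Linfty_shift haar_mu).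
have bffx i j : Linfty mu (fun s => f (s + x i) * (f (s + x j))^*).
  by apply: LinftyM => //; exact: Linfty_conj.
have bcffx i j : Linfty mu
    (fun s => c i * (c j)^* * (f (s + x i) * (f (s + x j))^*)).
  by apply: LinftyM => //; exact: Linfty_cst.
apply: (@limn_complex_ge0 _ (fun k => cmean mu (A k) (fun s => S s * (S s)^*)));
  last by move=> k; apply: cmean_ge0 => s; exact: mul_conjC_ge0.
rewrite [X in X @ _ --> _](_ : _ = (fun k => \sum_(i < n) \sum_(j < n)
    (c i * (c j)^*) * cmean mu (A k) (fun s => f (s + x i) * (f (s + x j))^*))).
  apply: cvg_complex_sum => i; apply: cvg_complex_sum => j.
  rewrite mulrAC; apply: cvg_complexZ.
  suff -> : (fun k => cmean mu (A k) (fun s => f (s + x i) * (f (s + x j))^*)) =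
      (fun k => cmean mu (A k)
        (fun s => f (s - - x i) * (f (s - - x i - (x i - x j)))^*)).
    exact: (@cmean_shift_cvg (- x i) _ _ (Linfty_correlation (x i - x j) bf bf)
      (@eberlein_cvg f f (x i - x j) ff)).
  apply/funext => k; congr cmean; apply/funext => s.
  by rewrite opprK opprB addrA addrAC addrK.
apply/funext => k.
have mA := van_hove_measurable k; have Aoo := van_hove_lty k.
rewrite (_ : (fun s => _) = (fun s => \sum_(i < n) \sum_(j < n)
    c i * (c j)^* * (f (s + x i) * (f (s + x j))^*))).
  rewrite cmean_sum//; last by move=> i; exact: Linfty_sum.
  apply: eq_bigr => i _; rewrite cmean_sum//.
  by apply: eq_bigr => j _; rewrite cmeanZ.
apply/funext => s; rewrite /S rmorph_sum big_distrl /=; apply: eq_bigr => i _.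
rewrite big_distrr /=; apply: eq_bigr => j _.
by rewrite rmorphM /= mulrACA.
Qed.

Definition mean_sqr f n : R :=
  complex.Re (cmean mu (A n) (fun x => f x * (f x)^*)).

(** The extended integral in the seminorm is finite for an essentially bounded [f], so it agrees
    with the real integral in [mean_sqr], the quantity bounded by Cauchy-Schwarz. *)
Lemma besicovitch2E f : Linfty mu f ->
  besicovitch2 mu A f = (limn_esup (fun n => (mean_sqr f n)%:E) `^ 2^-1)%E.
Proof.
move=> bf; congr (limn_esup _ `^ _)%E; apply/funext => n.
have mA := van_hove_measurable n; have Aoo := van_hove_lty n.
have E x : complex.Re (f x * (f x)^*) = cmodulus (f x) ^+ 2.
  by rewrite cReM cRe_conj cIm_conj mulrN opprK cmodulus_sqr !expr2.
rewrite /mean_sqr Re_cmean EFinM; congr (_ * _)%E.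
have /LinftyP[bff _] := LinftyM bf (Linfty_conj bf).
rewrite /Rintegral fineK; first by apply: eq_integral => x _; rewrite E.
apply: integrable_fin_num => //; exact: (ess_bounded_integrable mA Aoo bff).
Qed.

(** The limsup is an infimum of suprema over neighbourhoods of infinity; one of these suprema is
    already below [l + e]. *)
Lemma limn_esup_near_le (u : nat -> R) (l e : R) :
  limn_esup (fun n => (u n)%:E) = l%:E -> 0 < e ->
  \forall n \near \oo, u n <= l + e.
Proof.
move=> ul e0.
have : (limn_esup (fun n => (u n)%:E) < (l + e)%:E)%E.
  by rewrite ul lte_fin ltrDl.
move=> /ereal_inf_lt[_ [V Voo <-] Vle]; apply: filterS Voo => n Vn.
rewrite -lee_fin; apply: le_trans (ltW Vle).
by apply: ereal_sup_ubound; exists n.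
Qed.

Lemma mean_sqr_bounded f : Linfty mu f -> exists M : R, forall n, mean_sqr f n <= M.
Proof.
move=> bf; have /LinftyP[[mF [M FM]] _] := LinftyM bf (Linfty_conj bf).
exists `|M| => n; rewrite /mean_sqr Re_cmean mulrC ler_pdivrMr ?(vol_gt0 haar_mu vhA)//.
apply: (le_trans (ler_norm _)); apply: normr_Rintegral_le => //.
- exact: van_hove_measurable.
- exact: van_hove_lty.
- by apply: filterS FM => x /le_trans; apply; exact: ler_norm.
Qed.

(** The essential bound of [|f| ^+ 2] bounds all the means, so the limsup is a real number and the
    seminorm a real square root. *)
Lemma mean_sqr_limn_esup f : Linfty mu f ->
  exists2 l : R, 0 <= l & limn_esup (fun n => (mean_sqr f n)%:E) = l%:E.
Proof.
move=> /mean_sqr_bounded[M fM]; set L := limn_esup _.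
have L0 : (0 <= L)%E.
  apply: limf_esup_ge0 => [|n]; first exact: filter_not_empty.
  by rewrite lee_fin; exact: Re_cmean_ge0.
have LM : (L <= M%:E)%E.
  apply: (@le_trans _ _ (ereal_sup [set (mean_sqr f n)%:E | n in [set: nat]])).
    by apply: ereal_inf_lbound; exists setT => //; exact: filterT.
  by apply: ge_ereal_sup => _ [n _ <-]; rewrite lee_fin.
exists (fine L); first exact: fine_ge0.
by rewrite fineK// ge0_fin_numE// (le_lt_trans LM)// ltry.
Qed.

Lemma mean_sqr_shift t f : Linfty mu f ->
  mean_sqr (fun x => f (x - t)) n - mean_sqr f n @[n --> \oo] --> (0 : R).
Proof.
move=> bf; have /LinftyP[bF _] := LinftyM bf (Linfty_conj bf).
have := mean_shift_cvg0 hausG haar_mu vhA t bF.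
by under eq_fun do rewrite -!Re_cmean.
Qed.

Lemma eberlein_le_besicovitch f g t : Linfty mu f -> Linfty mu g ->
  eberlein_exists mu A f g ->
  ((cmodulus (eberlein mu A f g t))%:E
    <= besicovitch2 mu A f * besicovitch2 mu A g)%E.
Proof.
move=> bf bg fg; rewrite !besicovitch2E//.
have [a a0 fa] := mean_sqr_limn_esup bf; have [b b0 gb] := mean_sqr_limn_esup bg.
rewrite fa gb !poweR_EFin -EFinM lee_fin !powR12_sqrt// -sqrtrM//.
rewrite -[leLHS]ger0_norm ?cmodulus_ge0// -sqrtr_sqr ler_wsqrtr//.
apply/ler_addgt0Pr => d d0.
(* Since [(a + e) * (b + 2 * e) = a * b + e * (2 * a + b + 2 * e)] and [e <= 1], the excess over
   [a * b] is at most [e * K <= d]. *)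
pose K := 2 * a + b + 2; have K0 : 0 < K by rewrite /K; lra.
pose e := Num.min 1 (d / K).
have e0 : 0 < e by rewrite /e lt_min ltr01 divr_gt0.
have eK : e * K <= d by rewrite -ler_pdivlMr// /e ge_min lexx orbT.
have e1 : e <= 1 by rewrite /e ge_min lexx.
apply: (@le_trans _ _ ((a + e) * (b + e + e))); last first.
  have -> : (a + e) * (b + e + e) = a * b + e * (2 * a + b + 2 * e) by ring.
  rewrite lerD2l (le_trans _ eK)// ler_wpM2l ?(ltW e0)// /K; lra.
have cz := cvg_cmodulus (@eberlein_cvg f g t fg).
have cz2 : cmodulus (eberlein_mean mu A f g t n) ^+ 2 @[n --> \oo] -->
    cmodulus (eberlein mu A f g t) ^+ 2.
  by rewrite expr2; under eq_fun do rewrite expr2; exact: cvgM.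
rewrite -(cvg_lim _ cz2)//; apply: limr_le.
  by apply/cvg_ex; eexists; exact: cz2.
have bgt : Linfty mu (fun x => g (x - t)) by exact: (Linfty_shift haar_mu (- t)).
have /cvgrPdist_le/(_ _ e0) shift := mean_sqr_shift t bg.
near=> n; apply: le_trans (cmean_Cauchy_Schwarz (van_hove_measurable n)
  (van_hove_lty n) bf bgt) _.
apply: ler_pM; [exact: Re_cmean_ge0|exact: Re_cmean_ge0| |].
  by near: n; exact: limn_esup_near_le.
have gn : mean_sqr g n <= b + e by near: n; exact: limn_esup_near_le.
(* The second [e] in the factor for [g] pays for replacing its translate by [g] itself. *)
have : `|0 - (mean_sqr (fun x => g (x - t)) n - mean_sqr g n)| <= e by near: n.
rewrite sub0r normrN ler_norml -/(mean_sqr (fun x => g (x - t)) n) => /andP[_].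
by rewrite lerBlDr => /le_trans; apply; rewrite addrC lerD2r.
Unshelve. all: by end_near. Qed.

(** At [0] the means are exactly those of [|f| ^+ 2]. They converge by hypothesis, so their limsup
    is their limit, and squaring removes the root in the seminorm. *)
Lemma eberlein_diag0 f : Linfty mu f -> eberlein_exists mu A f f ->
  [/\ complex.Im (eberlein mu A f f 0) = 0,
      0 <= complex.Re (eberlein mu A f f 0) &
      (complex.Re (eberlein mu A f f 0))%:E = (besicovitch2 mu A f ^+ 2)%E].
Proof.
move=> bf /(@eberlein_cvg f f 0) ff.
have E : eberlein_mean mu A f f 0 =
    (fun n => cmean mu (A n) (fun x => f x * (f x)^*)).
  by apply/funext => n; congr cmean; apply/funext => x; rewrite subr0.
rewrite E in ff.
have : (0 : R[i]) <= eberlein mu A f f 0.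
  apply: limn_complex_ge0 ff _ => n; apply: cmean_ge0 => x; exact: mul_conjC_ge0.
rewrite lecE => /andP[/eqP I0 R0]; split => //.
have [fr _] := (cvg_complexP _ _).1 ff.
have [_ fE] : ((limn_einf (fun n => (mean_sqr f n)%:E) =
    (complex.Re (eberlein mu A f f 0))%:E) *
    (limn_esup (fun n => (mean_sqr f n)%:E) =
    (complex.Re (eberlein mu A f f 0))%:E))%type.
  by apply: cvg_limn_einf_sup; apply: cvg_EFin => //; exact: nearW.
by rewrite besicovitch2E// fE poweR_EFin powR12_sqrt// -EFin_expe sqr_sqrtr.
Qed.

End VanHoveMean.

Theorem proposition3p10 (R : realType) (G : topologicalZmodType)
    (mu : {measure set (borel G) -> \bar R}) (A : nat -> set G)
    (hausG : hausdorff_space G) (scG : @second_countable G)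
    (lcG : locally_compact [set: G])
    (haar_mu : haar_measure mu) (vhA : van_hove mu A) :
  (forall f g : G -> R[i], Linfty mu f -> Linfty mu g ->
     eberlein_exists mu A f g ->
     forall t : G,
       [/\ eberlein_exists mu A (translate t f) (translate t g),
           eberlein mu A (translate t f) (translate t g) = eberlein mu A f g,
           eberlein_exists mu A f (translate t g) &
           eberlein mu A f g
             = translate t (eberlein mu A f (translate t g))]) /\
  (forall (f g h : G -> R[i]) (a b : R[i]),
     Linfty mu f -> Linfty mu g -> Linfty mu h ->
     (eberlein_exists mu A f g -> eberlein_exists mu A g f ->
        eberlein mu A g f = conj_reflect (eberlein mu A f g)) /\
     (eberlein_exists mu A f g -> eberlein_exists mu A h g ->
      eberlein_exists mu A (fun x => a * f x + b * h x) g ->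
        eberlein mu A (fun x => a * f x + b * h x) g
          = (fun t => a * eberlein mu A f g t + b * eberlein mu A h g t)) /\
     (eberlein_exists mu A f g -> eberlein_exists mu A f h ->
      eberlein_exists mu A f (fun x => a * g x + b * h x) ->
        eberlein mu A f (fun x => a * g x + b * h x)
          = (fun t => a^* * eberlein mu A f g t + b^* * eberlein mu A f h t)) /\
     (eberlein_exists mu A f f -> positive_definite (eberlein mu A f f)) /\
     (eberlein_exists mu A f g ->
        (sup_norm (eberlein mu A f g)
          <= besicovitch2 mu A f * besicovitch2 mu A g)%E) /\
     (eberlein_exists mu A f f ->
        [/\ complex.Im (eberlein mu A f f 0) = 0,
            (complex.Re (eberlein mu A f f 0))%:E
              = sup_norm (eberlein mu A f f) &
            sup_norm (eberlein mu A f f) = (besicovitch2 mu A f ^+ 2)%E])).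
Proof.
split=> [f g bf bg fg t|f g h a b bf bg bh].
  split.
  - by move=> s; apply/cvg_ex; eexists; exact: eberlein_shift_cvg.
  - by apply/funext => s; apply: eberlein_eq; exact: eberlein_shift_cvg.
  (* Existence at [s] comes from the existence of [[f, g]] at [s + t]. *)
  - move=> s; rewrite -[s](addrK t) eberlein_translater; exact: fg.
  - by apply/funext => s; rewrite /translate /eberlein eberlein_translater.
split; first by move=> fg _; exact: eberlein_conj.
split; first by move=> fg hg _; exact: eberlein_linearl.
split; first by move=> fg hg _; exact: eberlein_linearr.
split; first exact: eberlein_positive_definite.
split.
  move=> fg; apply: ge_ereal_sup => _ [t _ <-].
  exact: eberlein_le_besicovitch.
move=> ff; have [I0 R0 RE] := eberlein_diag0 haar_mu vhA bf ff.
have -> : sup_norm (eberlein mu A f f) = (complex.Re (eberlein mu A f f 0))%:E.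
  (* The upper bound is the Cauchy-Schwarz inequality with [g = f]; the lower bound holds because
     the value at [0] is a nonnegative real, hence its own modulus. *)
  apply/eqP; rewrite eq_le; apply/andP; split.
    apply: ge_ereal_sup => _ [t _ <-]; rewrite RE expe2.
    exact: eberlein_le_besicovitch.
  apply: ereal_sup_ubound; exists 0 => //.
  by rewrite cmodulusE I0 expr0n addr0 sqrtr_sqr ger0_norm.
by split.
Qed.
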